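(* Let $F$ be a commutative field and let $\Omega$ be a line partition of $\mathrm{PG}(n,F)$. Let $K$ be the set of all planes $\varepsilon$ for which there exists a line $\ell$ with $\ell\subseteq\varepsilon\subseteq\ell^{\pi_\Omega}$. Then $K$ is a linear complex of planes if and only if $\Omega$ is linear. In this case $K$ has no singular line.
   Context: A line spread of a projective space is a set of lines such that each point lies on exactly one of them. A line partition $\Omega$ of $\mathrm{PG}(n,F)$ is a partition of its set of lines into line spreads of hyperplanes such that each hyperplane contains exactly one of these spreads; $\pi_\Omega$ maps each line $\ell$ to the hyperplane containing the class of $\ell$. $\Omega$ is linear if $\pi_\Omega$, viewed as a map from the Grassmannian $\Gamma(n,1,F)$ of lines (G-lines = pencils of lines in a plane through a point) to the dual space $\mathrm{PG}(n,F)^*$, is a linear mapping: for each pencil $\ell$ of lines, either $\pi_\Omega$ maps $\ell$ bijectively onto a line of $\mathrm{PG}(n,F)^*$ (a pencil of hyperplanes through an $(n-2)$-subspace), or (since $\pi_\Omega$ is global) this is the only allowed option for linear mappings without exceptional points. A linear complex of planes is the set of planes whose Plücker image $F(v_0\wedge v_1\wedge v_2)$ lies in a fixed hyperplane of $\mathbb P(\bigwedge^3F^{n+1})$; a line is singular for it if all planes through the line belong to it. *)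

(* Defs.v *)
From HB Require Import structures.
From mathcomp Require Import all_boot all_order all_algebra.
Set Implicit Arguments. Unset Strict Implicit. Unset Printing Implicit Defensive.
Import GRing.Theory.
Local Open Scope ring_scope.

Section PG.
Variables (F : fieldType) (n : nat).
Notation Sub := {vspace 'rV[F]_(n.+1)}.

Definition is_point (U : Sub) := \dim U = 1%N.
Definition is_line (U : Sub) := \dim U = 2%N.
Definition is_plane (U : Sub) := \dim U = 3%N.
Definition is_hyperplane (U : Sub) := \dim U = n.

Definition line_spread (H : Sub) (S : Sub -> Prop) :=
  (forall l, S l -> is_line l /\ (l <= H)%VS) /\
  (forall p, is_point p -> (p <= H)%VS -> exists! l, S l /\ (p <= l)%VS).

Definition line_partition (Om : (Sub -> Prop) -> Prop) :=
  (forall C, Om C -> exists H, is_hyperplane H /\ line_spread H C) /\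
  (forall l, is_line l -> exists! C, Om C /\ C l) /\
  (forall H, is_hyperplane H -> exists! C, Om C /\ (forall m, C m -> (m <= H)%VS)).

Definition pi_rel (Om : (Sub -> Prop) -> Prop) (l H : Sub) :=
  is_hyperplane H /\ exists C, Om C /\ C l /\ (forall m, C m -> (m <= H)%VS).

Definition in_pencil (p e l : Sub) := is_line l /\ (p <= l)%VS /\ (l <= e)%VS.

(* Om is linear: pi_Om maps every pencil of lines bijectively onto a line of the
   dual space, i.e. onto the pencil of hyperplanes through some (n-2)-dimensional
   projective subspace S (vector dimension n-1). *)
Definition linear_partition (Om : (Sub -> Prop) -> Prop) :=
  forall p e, is_point p -> is_plane e -> (p <= e)%VS ->
  exists S : Sub, \dim S = (n - 1)%N /\
    (forall l H, in_pencil p e l -> pi_rel Om l H -> (S <= H)%VS) /\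
    (forall H, is_hyperplane H -> (S <= H)%VS ->
        exists l, in_pencil p e l /\ pi_rel Om l H) /\
    (forall l l' H, in_pencil p e l -> in_pencil p e l' ->
        pi_rel Om l H -> pi_rel Om l' H -> l = l').

Definition K_of (Om : (Sub -> Prop) -> Prop) (e : Sub) :=
  is_plane e /\ exists l H, is_line l /\ pi_rel Om l H /\ (l <= e)%VS /\ (e <= H)%VS.

Definition plucker (v : 3.-tuple 'rV[F]_(n.+1)) (i j k : 'I_(n.+1)) : F :=
  \det (\matrix_(r < 3, s < 3) (tnth v r) 0 (tnth [tuple i; j; k] s)).

(* Value of the linear form with coefficients c (on the basis e_i/\e_j/\e_k,
   i<j<k, of the third exterior power) at the Plucker vector of v. *)
Definition plucker_form (c : 'I_(n.+1) -> 'I_(n.+1) -> 'I_(n.+1) -> F)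
    (v : 3.-tuple 'rV[F]_(n.+1)) : F :=
  \sum_(i < n.+1) \sum_(j < n.+1) \sum_(k < n.+1 | (i < j)%N && (j < k)%N)
     c i j k * plucker v i j k.

(* A linear complex of planes: the set of planes whose Plucker image lies in a
   fixed hyperplane of P(/\^3 F^(n+1)), i.e. the kernel of a nonzero linear form. *)
Definition linear_complex (K : Sub -> Prop) :=
  exists c : 'I_(n.+1) -> 'I_(n.+1) -> 'I_(n.+1) -> F,
    (exists i j k : 'I_(n.+1), [/\ (i < j)%N, (j < k)%N & c i j k != 0]) /\
    (forall e, K e <-> (is_plane e /\
        exists v : 3.-tuple 'rV[F]_(n.+1), e = <<v>>%VS /\ plucker_form c v = 0)).

Definition singular_line (K : Sub -> Prop) (l : Sub) :=
  is_line l /\ forall e, is_plane e -> (l <= e)%VS -> K e.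

End PG.

(* Main.v *)
Require Import Defs.
From HB Require Import structures.
From mathcomp Require Import all_boot all_order all_algebra.
From mathcomp Require Import boolp ring zify.
Set Implicit Arguments. Unset Strict Implicit. Unset Printing Implicit Defensive.
Import GRing.Theory.
Local Open Scope ring_scope.

(* For each line <p, x> pick a functional f p x with kernel the hyperplane
   assigned to it; since f p x vanishes on p and x, the claim is that the f p x
   can be rescaled into one alternating trilinear form T p x y.  This is done
   twice by the same cocycle argument.  For fixed p linearity of the partition
   gives f p (x + y) = b (m(x, y) f p x + f p y), where the ratios m satisfy
   m(x, y) m(y, z) = m(x, z), so m is a coboundary and f p becomes skew.  Then
   f p x and f x p are proportional, and the ratios again form a cocycle.
   Conversely, the form of a linear complex has T p x y = 0 for y in the
   hyperplane of <p, x>; if T p x vanished for one line, injectivity of the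
   correspondence at each point would make T vanish everywhere.  So the
   hyperplane of <p, x> is the kernel of T p x, which depends linearly on the
   line and is never the whole space. *)

(** * Functionals and spans *)

Section VectorFacts.
Variables (K : fieldType) (vT : vectType K).
Implicit Types (s t : seq vT) (f g h : 'Hom(vT, K^o)).

(** Freeness passes to subfamilies and is insensitive to order; counting multiplicities expresses
    both at once. *)
Lemma free_le_count s t :
  (forall x, count_mem x s <= count_mem x t)%N -> free t -> free s.
Proof.
move=> /count_subseqP[r /perm_to_subseq[q /perm_free tq] /perm_free->].
by rewrite tq => /catl_free.
Qed.

Lemma exists_notin_span s :
  (size s < \dim {:vT})%N -> exists w, w \notin <<s>>%VS.
Proof.
move=> lt_s; have /subvPn[w _ w_s] : ~~ (fullv <= <<s>>)%VS.
  by apply/negP=> /dimvS le_s; move: (leq_trans le_s (dim_span s)); rewrite leqNgt lt_s.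
by exists w.
Qed.

Lemma mem_span_dependent x s : free s -> ~~ free (x :: s) -> x \in <<s>>%VS.
Proof. by rewrite free_cons => ->; rewrite andbT negbK. Qed.

Lemma span_cons_sub x s t :
  x \in <<t>>%VS -> (<<s>> <= <<t>>)%VS -> (<<x :: s>> <= <<t>>)%VS.
Proof. by rewrite span_cons subv_add -memvE => ->. Qed.

(** A vector outside a span is outside every smaller span, so one auxiliary [w] can serve several
    families. *)
Lemma free_transfer w s t :
  free (w :: t) -> free s -> (<<s>> <= <<t>>)%VS -> free (w :: s).
Proof.
rewrite !free_cons => /andP[w_t _] -> /subvP st; rewrite andbT.
by apply: contra w_t; apply: st.
Qed.

Lemma functionalZ f k w : f (k *: w) = k * f w :> K.
Proof. by rewrite linearZ. Qed.

Lemma functionalD f v w : f (v + w) = f v + f w :> K.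
Proof. by rewrite linearD. Qed.

Lemma functionalB f v w : f (v - w) = f v - f w :> K.
Proof. by rewrite linearB. Qed.

Lemma memv_kerE f v : (v \in lker f) = (f v == 0 :> K).
Proof. exact: memv_ker. Qed.

(** If [f w] is nonzero, subtracting from [y] the multiple of [w] that cancels [f y] lands in the
    kernel of [f], hence of [g]. *)
Lemma functional_proportional f g :
  (lker f <= lker g)%VS -> exists a, g = a *: f.
Proof.
move=> /subvP fg; have [f0|/lfunPn[w]] := eqVneq f 0.
  exists 0; rewrite scale0r; apply/lfunP=> y; apply/eqP.
  by rewrite zero_lfunE -memv_ker fg // memv_ker f0 zero_lfunE.
rewrite zero_lfunE => fw; exists (g w / f w); apply/lfunP=> y.
have /fg : y - (f y / f w) *: w \in lker f.
  by rewrite memv_ker linearB linearZ /= /GRing.scale /= divfK // subrr.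
rewrite memv_ker linearB linearZ /= subr_eq0 => /eqP ->.
by rewrite lfunE /= /GRing.scale /= [LHS]mulrC [RHS]mulrAC mulrA.
Qed.

(** The vectors [u] and [v] behave as a dual basis to [f] and [g]: removing their components from
    [y] leaves a vector killed by both, so [h] is determined by [h u] and [h v]. *)
Lemma functional_lin2 f g h :
  ~~ (lker f <= lker g)%VS -> ~~ (lker g <= lker f)%VS ->
  (lker f :&: lker g <= lker h)%VS -> exists a b, h = a *: f + b *: g.
Proof.
move=> /subvPn[v + gv] /subvPn[u + fu] /subvP fgh.
rewrite !memv_kerE in gv fu *; move=> /eqP fv /eqP gu.
exists (h u / f u), (h v / g v); apply/lfunP=> y.
have /fgh : y - (f y / f u) *: u - (g y / g v) *: v \in (lker f :&: lker g)%VS.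
  rewrite memv_cap !memv_kerE !functionalB !functionalZ fv gu.
  by rewrite !mulr0 !subr0 !divfK // !subrr eqxx.
rewrite memv_kerE !functionalB !functionalZ -addrA -opprD subr_eq0 => /eqP ->.
rewrite add_lfunE !scale_lfunE /= /GRing.scale /=.
by congr (_ + _); rewrite [LHS]mulrAC [RHS]mulrAC; congr (_ / _); rewrite mulrC.
Qed.

Lemma exists_functional (H : {vspace vT}) :
  (\dim H).+1 = \dim {:vT} -> exists f, f != 0 /\ lker f = H.
Proof.
move=> dimH; have dimC : \dim H^C = 1%N by rewrite dimv_compl -dimH subSnn.
set w := vpick H^C; have w0 : w != 0 by rewrite vpick0 -dimv_eq0 dimC.
have Cw : (H^C = <[w]>)%VS.
  by apply/esym/eqP; rewrite eqEdim -memvE memv_pick dim_vline w0 dimC.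
have capC : (H^C :&: H = 0)%VS by rewrite capvC capv_compl.
(* The functional is the coordinate along the generator [w] of the complement, after projection
   parallel to [H]. *)
pose pr := daddv_pi H^C H.
pose e := [tuple w].
have fe : free e by rewrite /= seq1_free.
pose f : 'Hom(vT, K^o) := linfun (coord e ord0 : vT -> K^o).
have kf y : ((f \o pr)%VF y == 0) = (y \in H).
  have : pr y \in <[w]>%VS by rewrite -Cw memv_pi.
  case/vlineP=> k prk; rewrite comp_lfunE lfunE /= prk linearZ /=.
  rewrite (_ : w = e`_(@ord0 0)) // coord_free // eqxx /GRing.scale /= mulr1.
  apply/eqP/idP=> [k0|yH].
    have := daddv_pi_add capC (_ : y \in (H^C + H)%VS).
    rewrite addvC addv_complf memvf => /(_ isT) <-.
    by rewrite -/pr prk k0 scale0r add0r memv_pi.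
  have : pr y = 0.
    have yCH : y \in (H^C + H)%VS by rewrite addvC addv_complf memvf.
    have := daddv_pi_add capC yCH; rewrite [X in _ + X]daddv_pi_id // 1?capvC //.
    by move=> /(congr1 (fun z => z - y)); rewrite addrK subrr.
  by move=> pr0; move: prk; rewrite pr0 => /esym/eqP; rewrite scaler_eq0 (negPf w0) orbF => /eqP.
exists (f \o pr)%VF; split; last by apply/vspaceP=> y; rewrite memv_ker kf.
apply/eqP=> f0; have : w \in H by rewrite -kf f0 zero_lfunE.
move=> wH; case/negP: w0; rewrite -memv0 -capC memv_cap wH andbT; exact: memv_pick.
Qed.

End VectorFacts.

(** * Multiplicative cocycles on independent pairs *)

(** Derives freeness from a larger or reordered free family. Abstracting the equality tests turns
    the comparison of multiplicities into linear arithmetic. *)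
Ltac free_from H :=
  by apply: free_le_count H => ? /=;
     repeat match goal with |- context [nat_of_bool ?b] =>
       move: (nat_of_bool b) => ? end; clear; lia.

Section Cocycle.
Variables (K : fieldType) (vT : vectType K) (P : seq vT) (mu : vT -> vT -> K).
Hypothesis dimP : (size P + 2 < \dim {:vT})%N.
Hypothesis freeP : free P.
Hypothesis mu_neq0 : forall x y, mu x y != 0.
Hypothesis mu_cocycle : forall x y z,
  free [:: x, y, z & P] -> mu x y * mu y z = mu x z.

Let extend2 x y : free [:: x, y & P] -> exists z, free [:: z, x, y & P].
Proof.
move=> fxy; have [|z zP] := @exists_notin_span _ _ [:: x, y & P].
  by rewrite /= -addn2.
by exists z; rewrite free_cons zP.
Qed.

(** With a third independent [z], going from [y] to [x] and then to [z] agrees with going from [y]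
    to [z]; the nonzero [mu y z] cancels. *)
Lemma cocycle_inv x y : free [:: x, y & P] -> mu x y * mu y x = 1.
Proof.
move=> fxy; have [z fz] := extend2 fxy.
apply: (mulIf (mu_neq0 y z)); rewrite mul1r -mulrA [mu y x * _]mulrC mulrA.
rewrite mu_cocycle; last by free_from fz.
by rewrite mulrC mu_cocycle //; free_from fz.
Qed.

(** If the triple is dependent modulo [P], a vector [w] outside its span makes each of the three
    pairs part of an independent triple, and each ratio is routed through [w]. *)
Lemma cocycle_pairwise x y u :
  free [:: x, y & P] -> free [:: y, u & P] -> free [:: x, u & P] ->
  mu x y * mu y u = mu x u.
Proof.
move=> fxy fyu fxu.
case: (boolP (free [:: u, x, y & P])) => [fuxy|nf].
  by apply: mu_cocycle; free_from fuxy.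
have u_xy := mem_span_dependent fxy nf.
have [w fw] := extend2 fxy.
have x_xy : x \in <<[:: x, y & P]>>%VS by rewrite memv_span // mem_head.
have y_xy : y \in <<[:: x, y & P]>>%VS by rewrite memv_span // !inE eqxx orbT.
have PS : (<<P>> <= <<[:: x, y & P]>>)%VS.
  by apply: sub_span => z zP; rewrite !inE zP !orbT.
have fwyu : free [:: w, y, u & P].
  by apply: free_transfer fw fyu _; do 2!apply: span_cons_sub => //.
have fwxu : free [:: w, x, u & P].
  by apply: free_transfer fw fxu _; do 2!apply: span_cons_sub => //.
have <- : mu x w * mu w y = mu x y by apply: mu_cocycle; free_from fw.
have <- : mu y w * mu w u = mu y u by apply: mu_cocycle; free_from fwyu.
have <- : mu x w * mu w u = mu x u by apply: mu_cocycle; free_from fwxu.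
have wy : mu w y * mu y w = 1 by apply: cocycle_inv; free_from fw.
by rewrite mulrA -[_ * mu y w]mulrA wy mulr1.
Qed.

(** The family [P] lets one argument serve both rescalings: it is a single vector in the first and
    empty in the second. *)
Lemma cocycle_coboundary : exists g : vT -> K, (forall x, g x != 0) /\
  (forall x y, free [:: x, y & P] -> mu x y * g y = g x).
Proof.
have lt1 : (size P < \dim {:vT})%N by lia.
have [z0 z0P] := exists_notin_span lt1.
have fz0 : free (z0 :: P) by rewrite free_cons z0P.
have lt2 : (size (z0 :: P) < \dim {:vT})%N by rewrite /=; lia.
have [z1 z1P] := exists_notin_span lt2.
have fz1 : free [:: z1, z0 & P] by rewrite free_cons z1P.
(* The natural potential is the ratio to a base vector [z0]; vectors dependent on [z0] modulo [P]
   reach it through [z1]. *)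
exists (fun x => if free [:: x, z0 & P] then mu x z0 else mu x z1 * mu z1 z0).
split=> [x|x y fxy]; first by case: ifP; rewrite ?mulf_neq0.
have near_z0 x' w : free (x' :: P) -> ~~ free [:: x', z0 & P] ->
    free [:: w, z0 & P] -> free [:: w, x' & P].
  move=> fx' /(mem_span_dependent fz0) x'z0 fw; apply: free_transfer fw fx' _.
  apply: span_cons_sub => //.
  by apply: sub_span => z zP; rewrite inE zP orbT.
have half x' y' : free [:: x', y' & P] -> ~~ free [:: x', z0 & P] ->
    free [:: y', z0 & P] -> mu x' y' * mu y' z0 = mu x' z1 * mu z1 z0.
  move=> fxy' nx fy'.
  have fx' : free (x' :: P) by free_from fxy'.
  have fz1x : free [:: z1, x' & P] by apply: near_z0.
  have [w fw] := extend2 fz1.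
  have fwx : free [:: w, x' & P] by apply: near_z0 => //; free_from fw.
  case: (boolP (free [:: y', z1 & P])) => [fyz1|nyz1].
    rewrite -(@cocycle_pairwise x' z1 y') //; try by [free_from fz1x|free_from fyz1].
    by rewrite -mulrA cocycle_pairwise //; free_from fyz1.
  (* Here [y'] depends on [z1] modulo [P], so the path from [x'] to [y'] makes a detour through [w],
     independent of both [z0] and [z1]. *)
  have fy'0 : free (y' :: P) by free_from fy'.
  have fz10 : free (z1 :: P) by free_from fz1.
  have fwy : free [:: w, y' & P].
    have fwz1 : free [:: w, z1 & P] by free_from fw.
    apply: free_transfer fwz1 fy'0 _; apply: span_cons_sub.
      exact: mem_span_dependent nyz1.
    by apply: sub_span => z zP; rewrite inE zP orbT.
  have fwz0 : free [:: w, z0 & P] by free_from fw.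
  have fwz1 : free [:: w, z1 & P] by free_from fw.
  rewrite -(@cocycle_pairwise x' w y') //; last by free_from fwx.
  rewrite -(@cocycle_pairwise x' z1 w) //; try by [free_from fz1x|free_from fwz1|free_from fwx].
  by rewrite -!mulrA cocycle_pairwise // cocycle_pairwise //; free_from fwz1.
case: ifP => fy; case: ifP => fx.
- exact: cocycle_pairwise.
- by apply: half => //; rewrite fx.
- have fyx : free [:: y, x & P] by free_from fxy.
  by rewrite -(half y x) ?fy // mulrA cocycle_inv // mul1r.
(* Both vectors depend on [z0] modulo [P]; by dimension they then depend on each other, against the
   hypothesis. *)
- have fy0 : free (y :: P) by free_from fxy.
  have fx0 : free (x :: P) by free_from fxy.
  have yS : (<<y :: P>> <= <<z0 :: P>>)%VS.
    apply: span_cons_sub; first by apply: mem_span_dependent; rewrite ?fy.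
    by apply: sub_span => z zP; rewrite inE zP orbT.
  have xS : x \in <<z0 :: P>>%VS by apply: mem_span_dependent; rewrite ?fx.
  have yz : (<<z0 :: P>> <= <<y :: P>>)%VS.
    rewrite -(dimv_leqif_sup yS).
    have /eqP -> := fy0; have /eqP -> := fz0; exact: eqxx.
  by move: fxy; rewrite free_cons (subvP yz).
Qed.

End Cocycle.
(** * Assembling functionals into an alternating form *)

Section Avoidance.
Variables (K : fieldType) (vT : vectType K).
Implicit Types f g h : 'Hom(vT, K^o).

Lemma functional_neq0 f : f != 0 -> exists w, f w != 0 :> K.
Proof. by move=> /lfunPn[w]; rewrite zero_lfunE; exists w. Qed.

Lemma avoid_two_kernels f g : f != 0 -> g != 0 ->
  exists w, f w != 0 :> K /\ g w != 0 :> K.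
Proof.
move=> /functional_neq0[u fu] /functional_neq0[v gv].
have [gu|] := eqVneq (g u : K) 0; last by exists u.
have [fv|] := eqVneq (f v : K) 0; last by exists v.
by exists (u + v); rewrite !functionalD gu fv add0r addr0.
Qed.

(* Over the field with two elements three hyperplanes can cover the space. *)
Lemma avoid_three_kernels f g h (a : K) : a != 0 -> a != 1 ->
  f != 0 -> g != 0 -> h != 0 ->
  exists w, [/\ f w != 0 :> K, g w != 0 :> K & h w != 0 :> K].
Proof.
move=> a0 a1 f0 g0 /functional_neq0[u hu].
have [w [fw gw]] := avoid_two_kernels f0 g0.
have [hw|] := eqVneq (h w : K) 0; last by exists w.
(* Along [w + t *: u] the functional [k] is constant and [h] is nonzero for nonzero [t]. If [l]
   vanished at both [t = 1] and [t = a], it would vanish at [u] and then at [w]. *)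
have key (k l : 'Hom(vT, K^o)) : k u = 0 :> K -> k w != 0 :> K -> l w != 0 :> K ->
    exists v, [/\ k v != 0 :> K, l v != 0 :> K & h v != 0 :> K].
  move=> ku kw lw; have kt t : k (w + t *: u) = k w :> K.
    by rewrite functionalD functionalZ ku mulr0 addr0.
  have ht t : h (w + t *: u) = t * h u :> K.
    by rewrite functionalD functionalZ hw add0r.
  have [l1|] := eqVneq (l (w + 1 *: u) : K) 0; last first.
    by exists (w + 1 *: u); rewrite kt ht mul1r.
  have [la|] := eqVneq (l (w + a *: u) : K) 0; last first.
    by exists (w + a *: u); rewrite kt ht mulf_neq0.
  have lu : (a - 1) * l u = 0.
    by rewrite -[RHS](subrr (0 : K)) -{1}la -{1}l1 !functionalD !functionalZ; ring.
  move/eqP: lu l1; rewrite mulf_eq0 subr_eq0 (negPf a1) /= => /eqP lu.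
  by rewrite functionalD functionalZ lu mulr0 addr0 => l0; rewrite l0 eqxx in lw.
have [fu|fu] := eqVneq (f u : K) 0; first exact: key.
have [gu|gu] := eqVneq (g u : K) 0; last by exists u.
by have [v []] := key g f gu gw fw; exists v.
Qed.

End Avoidance.

(** Linearity in the other two arguments follows from the swaps. The diagonal condition is separate
    because skew symmetry does not imply it in characteristic two. *)
Record alternating3 (K : fieldType) (V : lmodType K) (T : V -> V -> V -> K) : Prop :=
  Alternating3 {
    alt3_linear : forall p x a y z, T p x (a *: y + z) = a * T p x y + T p x z;
    alt3_swap23 : forall p x y, T p x y = - T p y x;
    alt3_swap12 : forall p x y, T p x y = - T x p y;
    alt3_diag : forall p y, T p p y = 0 }.

Section TrilinearForm.
Variables (K : fieldType) (vT : vectType K) (f : vT -> vT -> 'Hom(vT, K^o)).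
Hypothesis dim4 : (3 < \dim {:vT})%N.
Hypothesis f_neq0 : forall p x, free [:: p; x] -> f p x != 0.
Hypothesis f_ker : forall p x, free [:: p; x] -> (<<[:: p; x]>> <= lker (f p x))%VS.
Hypothesis f_sym : forall p x, free [:: p; x] -> exists a, f x p = a *: f p x.
Hypothesis f_add : forall p x y, free [:: p; x; y] ->
  exists a b, f p (x + y) = a *: f p x + b *: f p y.
Hypothesis f_indep : forall p x y z a b, free [:: p; x; y; z] ->
  f p z != a *: f p x + b *: f p y.

Lemma f_coef0 p x y z a b c : free [:: p; x; y; z] ->
  a *: f p x + b *: f p y + c *: f p z = 0 -> c = 0.
Proof.
move=> fr e; have [//|c0] := eqVneq c 0.
case/eqP: (@f_indep p x y z (- c^-1 * a) (- c^-1 * b) fr).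
rewrite -!scalerA -scalerDr; apply: (scalerI c0).
by rewrite scalerA mulrN divff // scaleN1r; apply/eqP; rewrite -addr_eq0 addrC e.
Qed.

Lemma f_lin_indep p x y z a b c : free [:: p; x; y; z] ->
  a *: f p x + b *: f p y + c *: f p z = 0 -> [/\ a = 0, b = 0 & c = 0].
Proof.
move=> fr e; split; last exact: f_coef0 e.
  by apply: (@f_coef0 p y z x b c a); [free_from fr | rewrite addrC addrA].
by apply: (@f_coef0 p x z y a c b); [free_from fr | rewrite addrAC].
Qed.

Lemma f_coef_eq p x y z a b c a' b' c' : free [:: p; x; y; z] ->
  a *: f p x + b *: f p y + c *: f p z = a' *: f p x + b' *: f p y + c' *: f p z ->
  [/\ a = a', b = b' & c = c'].
Proof.
move=> fr e; suff [] : [/\ a - a' = 0, b - b' = 0 & c - c' = 0].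
  by move=> /subr0_eq-> /subr0_eq-> /subr0_eq->.
by apply: f_lin_indep fr _; rewrite !scalerBl [X in X + _]addrACA -opprD addrACA -opprD e subrr.
Qed.

Lemma extend_free (s : seq vT) : (size s < 4)%N -> free s -> exists z, free (z :: s).
Proof.
move=> s4 fs; have [|z zs] := @exists_notin_span _ _ s; first exact: leq_trans dim4.
by exists z; rewrite free_cons zs.
Qed.

Lemma free_addl x y (s : seq vT) : y \in <<s>>%VS -> free (x + y :: s) = free (x :: s).
Proof. by move=> ys; rewrite !free_cons rpredDr. Qed.

(** Both coefficients of [f p (x + y)] are nonzero: otherwise it would be a multiple of [f p x] or
    [f p y], which [f_indep] excludes once a fourth vector is added. The value 1 on dependent
    triples makes the ratio total, ready for choice. *)
Lemma f_ratio p x y : exists m : K, m != 0 /\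
  (free [:: p; x; y] -> exists b : K, b != 0 /\ f p (x + y) = (b * m) *: f p x + b *: f p y).
Proof.
have [fr|nf] := boolP (free [:: p; x; y]); last by exists 1; rewrite oner_neq0.
have [z fz] : exists z, free [:: z; p; x; y] by apply: extend_free.
have [a [b e]] := f_add fr.
have fxy : free [:: x + y; y; p; z].
  rewrite free_addl ?memv_span ?mem_head //; free_from fz.
have fyx : free [:: y + x; x; p; z].
  rewrite free_addl ?memv_span ?mem_head //; free_from fz.
have b0 : b != 0.
  apply: contraTneq isT => b0; move: e; rewrite b0 scale0r addr0 => e.
  have := @f_indep p x z (x + y) a 0; rewrite e scale0r addr0 eqxx => -> //.
  by rewrite addrC; free_from fyx.
have a0 : a != 0.
  apply: contraTneq isT => a0; move: e; rewrite a0 scale0r add0r => e.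
  have := @f_indep p y z (x + y) b 0; rewrite e scale0r addr0 eqxx => -> //.
  by free_from fxy.
by exists (a / b); split=> [|_]; [rewrite mulf_neq0 ?invr_eq0 | exists b; rewrite mulrCA divff ?mulr1].
Qed.

(* Comparing the three ways of bracketing [x + y + z] makes the ratios of the
   coefficients of [f p (x + y)] multiplicative, hence removable by rescaling. *)
Lemma f_rescale p : exists g : vT -> K, (forall x, g x != 0) /\
  (forall x y, free [:: p; x; y] -> g x * f p x y = - (g y * f p y x)).
Proof.
have [-> | p0] := eqVneq p 0.
  exists (fun _ => 1); split=> [x|x y /free_not0 /(_ (mem_head _ _))]; first exact: oner_neq0.
  by rewrite eqxx.
have [mu' muP] := choice (fun u : vT * vT => f_ratio p u.1 u.2).
pose mu x y := mu' (x, y).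
have mu0 x y : mu x y != 0 by have [] := muP (x, y).
have muE x y : free [:: p; x; y] ->
    exists b : K, b != 0 /\ f p (x + y) = (b * mu x y) *: f p x + b *: f p y.
  by have [] := muP (x, y).
have fp : free [:: p] by rewrite seq1_free.
have coc x y z : free [:: x, y, z & [:: p]] -> mu x y * mu y z = mu x z.
  move=> fr; have fr' : free [:: p; x; y; z] by free_from fr.
  have [b1 [b10 e1]] := muE x y ltac:(free_from fr).
  have [b2 [b20 e2]] := muE y z ltac:(free_from fr).
  have [b3 [b30 e3]] := muE x z ltac:(free_from fr).
  have frxy : free [:: x + y; y; p; z].
    by rewrite free_addl ?memv_span ?mem_head //; free_from fr.
  have fryz : free [:: y + z; z; p; x].
    by rewrite free_addl ?memv_span ?mem_head //; free_from fr.
  have frxz : free [:: x + z; z; p; y].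
    by rewrite free_addl ?memv_span ?mem_head //; free_from fr.
  have [b4 [b40 e4]] := muE (x + y) z ltac:(free_from frxy).
  have [b5 [b50 e5]] := muE x (y + z) ltac:(free_from fryz).
  have [b6 [b60 e6]] := muE y (x + z) ltac:(free_from frxz).
  rewrite addrA in e5; rewrite addrCA addrA in e6.
  rewrite e4 e1 e2 !scalerDr !scalerA addrA in e5.
  rewrite e4 e1 e3 !scalerDr !scalerA addrA [X in _ = X + _]addrC in e6.
  (* Independence of [f p x], [f p y], [f p z] allows comparing coefficients between the
     bracketings; eliminating the scale factors leaves the cocycle identity. *)
  have [c1 c2 c3] := f_coef_eq fr' e5.
  have [d1 d2 d3] := f_coef_eq fr' e6.
  have h : b4 * mu x z = b4 * mu (x + y) z * (b1 * mu x y) by rewrite d1 mulrA -d3.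
  by apply: (mulfI b40); rewrite h [RHS]mulrA c2 [b5 * _]mulrA -c3 [RHS]mulrAC mulrA.
have [g [g0 gE]] : exists g : vT -> K, (forall x, g x != 0) /\
    (forall x y, free [:: x, y & [:: p]] -> mu x y * g y = g x).
  apply: cocycle_coboundary => //.
exists g; split=> // x y fr; rewrite -(gE x y); last by free_from fr.
have [b [b0 e]] := muE x y fr.
have frx : free [:: p; x] by free_from fr.
have fry : free [:: p; y] by free_from fr.
have frxy : free [:: p; x + y].
  have : free [:: x + y; y; p].
    by rewrite free_addl ?memv_span ?mem_head //; free_from fr.
  by move=> h; free_from h.
have f_self q z : free [:: q; z] -> f q z z = 0 :> K.
  move=> /f_ker/subvP/(_ z); rewrite memv_kerE memv_span ?inE ?eqxx ?orbT //.
  by move=> /(_ isT)/eqP.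
(* Since [f p (x + y)] kills [x + y], while [f p x] kills [x] and [f p y] kills [y], only the mixed
   terms remain, and they give skewness. *)
have := f_self _ _ frxy; rewrite {1}e functionalD !add_lfunE !scale_lfunE /= /GRing.scale /=.
rewrite (f_self _ _ frx) (f_self _ _ fry) => E.
by apply: (mulfI b0); apply/eqP; rewrite -subr_eq0; apply/eqP; rewrite -[RHS](mulr0 (g y)) -[in RHS]E; ring.
Qed.

Lemma exists_alternating3 : exists T : vT -> vT -> vT -> K,
  alternating3 T /\
  forall p x y, free [:: p; x] -> (T p x y == 0) = (y \in lker (f p x)).
Proof.
have [G GP] := choice f_rescale.
have G0 p x : G p x != 0 by have [] := GP p.
have G_skew p x y : free [:: p; x; y] -> G p x * f p x y = - (G p y * f p y x) :> K.
  by have [_] := GP p; apply.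
(* The default 0 is the value an alternating form must take on dependent arguments, so the
   identities below only need checking on free families. *)
pose B p x y : K := if free [:: p; x] then G p x * f p x y else 0.
have BE p x y : free [:: p; x] -> B p x y = G p x * f p x y by rewrite /B => ->.
have B_dep p x y : ~~ free [:: p; x; y] -> B p x y = 0.
  rewrite /B => nf; case: ifP => // fpx; apply/eqP.
  rewrite mulf_eq0 (negPf (G0 p x)) /= -memv_kerE; apply: (subvP (f_ker fpx)).
  by apply: mem_span_dependent => //; apply: contra nf => h; free_from h.
have B_skew p x y : B p x y = - B p y x.
  have [fr|nf] := boolP (free [:: p; x; y]).
    have f1 : free [:: p; x] by free_from fr.
    have f2 : free [:: p; y] by free_from fr.
    by rewrite (BE _ _ _ f1) (BE _ _ _ f2) G_skew.
  have nf' : ~~ free [:: p; y; x] by apply: contra nf => h; free_from h.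
  by rewrite (B_dep _ _ _ nf) (B_dep _ _ _ nf') oppr0.
have B_lin p x a y z : B p x (a *: y + z) = a * B p x y + B p x z.
  rewrite /B; case: ifP => _; last by rewrite mulr0 addr0.
  by rewrite functionalD functionalZ mulrDr mulrCA.
have B_sym p x : exists m : K, m != 0 /\
    (free [:: p; x] -> forall y, B x p y = - (m * B p x y)).
  have [fr|nf] := boolP (free [:: p; x]); last by exists 1; rewrite oner_neq0.
  have fr' : free [:: x; p] by free_from fr.
  have [a e] := f_sym fr.
  have a0 : a != 0.
    by apply: contraNneq (f_neq0 fr') => a0; rewrite e a0 scale0r.
  exists (- (G x p * a / G p x)); split.
    by rewrite oppr_eq0 !mulf_neq0 ?invr_eq0.
  move=> _ y; rewrite !BE // e scale_lfunE /= /GRing.scale /= mulNr opprK.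
  by rewrite -[RHS]mulrA mulKf // mulrA.
have [mu' muP] := choice (fun u : vT * vT => B_sym u.1 u.2).
pose mu x y := mu' (x, y).
have mu0 x y : mu x y != 0 by have [] := muP (x, y).
have muE p x y : free [:: p; x] -> B x p y = - (mu p x * B p x y).
  by move=> fr; have [_] := muP (p, x); apply.
(* Two chains of swaps lead from [B x y z] to [B z x y], one through [B y x z] and one through
   [B x z y]; comparing their factors gives the identity. *)
have coc_generic x y z : B x y z != 0 -> mu x y * mu y z = mu x z.
  move=> nz; have fr : free [:: x; y; z].
    by apply: contraNT nz => /B_dep ->; rewrite eqxx.
  have e1 : B y x z = - (mu x y * B x y z) by apply: muE; free_from fr.
  have e2 : B z y x = - (mu y z * B y z x) by apply: muE; free_from fr.
  have e3 : B z x y = - (mu x z * B x z y) by apply: muE; free_from fr.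
  rewrite (B_skew y z) e1 opprK in e2; rewrite (B_skew x z) mulrN opprK B_skew e2 opprK in e3.
  by apply: (mulIf nz); rewrite -e3 mulrA [mu y z * _]mulrC.
have coc x y z : free [:: x; y; z] -> mu x y * mu y z = mu x z.
  move=> fr.
  (* If the field has two elements the nonzero ratios are all 1; otherwise a
     vector w off three kernels reduces the triple to generic ones. *)
  have [[a [a0 a1]]|bin] := pselect (exists a : K, a != 0 /\ a != 1); last first.
    have mu1 u v : mu u v = 1.
      by apply: contrapT => /eqP m1; apply: bin; exists (mu u v).
    by rewrite !mu1 mulr1.
  have fxy : free [:: x; y] by free_from fr.
  have fyz : free [:: y; z] by free_from fr.
  have fxz : free [:: x; z] by free_from fr.
  have [w [w1 w2 w3]] :=
    avoid_three_kernels a0 a1 (f_neq0 fxy) (f_neq0 fyz) (f_neq0 fxz).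
  have b1 : B x y w != 0 by rewrite BE // mulf_neq0.
  have b2 : B y z w != 0 by rewrite BE // mulf_neq0.
  have b3 : B x z w != 0 by rewrite BE // mulf_neq0.
  have b1' : B x w y != 0 by rewrite B_skew oppr_eq0.
  have b2' : B y w z != 0 by rewrite B_skew oppr_eq0.
  have b3' : B x w z != 0 by rewrite B_skew oppr_eq0.
  rewrite -(coc_generic _ _ _ b1') -(coc_generic _ _ _ b2') -(coc_generic _ _ _ b3').
  have wy : mu w y * mu y w = 1.
    apply: (mulfI (mu0 x w)); rewrite mulrA mulr1 (coc_generic _ _ _ b1').
    exact: coc_generic.
  by rewrite mulrA -[_ * mu y w]mulrA wy mulr1.
(* Multiplying by [lam p] absorbs the ratio between [B p x] and [B x p]; it preserves skewness in
   the last two arguments. *)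
have [lam [lam0 lamE]] : exists g : vT -> K, (forall x, g x != 0) /\
    (forall x y, free [:: x, y & [::]] -> mu x y * g y = g x).
  by apply: cocycle_coboundary => //; [apply: leq_trans dim4 | apply: nil_free].
exists (fun p x y => lam p * B p x y); split; last first.
  by move=> p x y fr; rewrite BE // !mulf_eq0 (negPf (lam0 _)) (negPf (G0 _ _)) memv_kerE.
split=> [p x a y z|p x y|p x y|p y].
- by rewrite B_lin mulrDr mulrCA.
- by rewrite B_skew mulrN.
- have [fr|nf] := boolP (free [:: p; x]).
    by rewrite (muE p x) // mulrN opprK -(lamE p x) // [RHS]mulrA [lam x * _]mulrC.
  have nf1 : ~~ free [:: p; x; y] by apply: contra nf => h; free_from h.
  have nf2 : ~~ free [:: x; p; y] by apply: contra nf => h; free_from h.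
  by rewrite (B_dep _ _ _ nf1) (B_dep _ _ _ nf2) !mulr0 oppr0.
- have nf : ~~ free [:: p; p; y] by apply/negP=> /free_uniq /=; rewrite inE eqxx.
  by rewrite (B_dep _ _ _ nf) mulr0.
Qed.

End TrilinearForm.

(** * Vanishing on spans, and bases of lines and planes *)

Section SpanFacts.
Variables (K : fieldType) (vT : vectType K).

(** Stated for plain functions so that it applies to any single argument of a trilinear form. *)
Lemma linear_eq0_span (h : vT -> K) (s : seq vT) :
  (forall a y z, h (a *: y + z) = a * h y + h z) ->
  (forall z, z \in s -> h z = 0) -> forall w, w \in <<s>>%VS -> h w = 0.
Proof.
move=> hlin hs; have h0 : h 0 = 0.
  by have := hlin (-1) 0 0; rewrite scaler0 addr0 mulN1r addNr.
elim: s hs => [|x s IHs] hs w.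
  by rewrite span_nil memv0 => /eqP ->.
rewrite span_cons => /memv_addP[_ /vlineP[a ->] [v vs ->]].
rewrite hlin hs ?mem_head // mulr0 add0r IHs // => z zs.
by apply: hs; rewrite inE zs orbT.
Qed.

Lemma dim_add_line w (U : {vspace vT}) :
  w \notin U -> \dim (<[w]> + U) = (\dim U).+1.
Proof.
move=> wU; rewrite dimv_disjoint_sum ?dim_vline.
  suff -> : w != 0 by rewrite add1n.
  by apply: contraNneq wU => ->; apply: mem0v.
apply/eqP; rewrite -subv0; apply/subvP=> v /memv_capP[/vlineP[a ->]].
have [->|a0] := eqVneq a 0; first by rewrite !scale0r !mem0v.
by move/(memvZ a^-1); rewrite scalerA mulVf // scale1r (negPf wU).
Qed.

(** Since [w] lies outside [H], every vector is a multiple of [w] plus an element of [H], and [h]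
    sees only the multiple. *)
Lemma linear_eq0_hyperplane (h : vT -> K) (H : {vspace vT}) w :
  (forall a y z, h (a *: y + z) = a * h y + h z) ->
  (forall z, z \in H -> h z = 0) -> (\dim H).+1 = \dim {:vT} -> h w != 0 ->
  forall y, (h y == 0) = (y \in H).
Proof.
move=> hlin hH dimH hw y; have wH : w \notin H.
  by apply: contra hw => /hH ->.
have : y \in (<[w]> + H)%VS.
  suff -> : (<[w]> + H = fullv)%VS by apply: memvf.
  by apply/eqP; rewrite eqEdim subvf -dimH dim_add_line //=.
case/memv_addP=> _ /vlineP[a ->] [v vH ->].
rewrite hlin (hH v) // addr0 mulf_eq0 (negPf hw) orbF rpredDr //.
have [->|a0] := eqVneq a 0; first by rewrite scale0r mem0v.
apply/esym/negbTE; apply: contra wH => /(memvZ a^-1).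
by rewrite scalerA mulVf // scale1r.
Qed.

Lemma free2C (p x : vT) : free [:: p; x] = free [:: x; p].
Proof. by apply/perm_free; rewrite (perm_catC [:: p]). Qed.

Lemma free3_notin (p x y : vT) : free [:: p; x; y] = (y \notin <<[:: p; x]>>%VS) && free [:: p; x].
Proof. by rewrite -(perm_free (_ : perm_eq [:: y; p; x] _)) ?free_cons // (perm_catC [:: y]). Qed.

Lemma dim2_span (U : {vspace vT}) : \dim U = 2%N ->
  exists p x, U = <<[:: p; x]>>%VS /\ free [:: p; x].
Proof.
move=> dU; have := vbasisP U; case: (vbasis U) => s /= /eqP; rewrite dU.
case: s => [|p [|x [|]]] //= _ b; exists p, x; split; last exact: basis_free b.
by rewrite (span_basis b).
Qed.

Lemma dim3_span (U : {vspace vT}) : \dim U = 3%N ->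
  exists p x y, U = <<[:: p; x; y]>>%VS /\ free [:: p; x; y].
Proof.
move=> dU; have := vbasisP U; case: (vbasis U) => s /= /eqP; rewrite dU.
case: s => [|p [|x [|y [|]]]] //= _ b; exists p, x, y; split; last exact: basis_free b.
by rewrite (span_basis b).
Qed.

Lemma free_span_eq (s : seq vT) (U : {vspace vT}) :
  free s -> (<<s>> <= U)%VS -> \dim U = size s -> U = <<s>>%VS.
Proof.
move=> /eqP fs sU dU; apply/esym/eqP; rewrite eqEdim sU /=.
by rewrite [X in (_ <= X)%N]fs dU.
Qed.

Lemma exists_mem_notin (U W : {vspace vT}) : (\dim W < \dim U)%N ->
  exists2 y, y \in U & y \notin W.
Proof.
move=> lt; apply/subvPn; apply: contraL lt => /dimvS; by rewrite -leqNgt.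
Qed.

Lemma extend_dim2 p (U : {vspace vT}) : p != 0 -> p \in U -> \dim U = 2%N ->
  exists x, U = <<[:: p; x]>>%VS /\ free [:: p; x].
Proof.
move=> p0 pU dU; have [|x xU xp] := @exists_mem_notin U <[p]>%VS.
  by rewrite dim_vline p0 dU.
have fr : free [:: x; p] by rewrite free_cons span_seq1 xp seq1_free.
have fr' : free [:: p; x] by free_from fr.
exists x; split=> //; apply: free_span_eq => //.
by apply/span_subvP=> z; rewrite !inE => /orP[] /eqP ->.
Qed.

Lemma extend_dim3 p x (U : {vspace vT}) : free [:: p; x] -> p \in U -> x \in U ->
  \dim U = 3%N -> exists y, U = <<[:: p; x; y]>>%VS /\ free [:: p; x; y].
Proof.
move=> fr pU xU dU; have [|y yU yl] := @exists_mem_notin U <<[:: p; x]>>%VS.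
  by have /eqP -> := fr; rewrite dU.
have fr' : free [:: p; x; y] by rewrite free3_notin yl.
exists y; split=> //; apply: free_span_eq => //.
by apply/span_subvP=> z; rewrite !inE => /or3P[] /eqP ->.
Qed.

Lemma span2C (p x : vT) : <<[:: p; x]>>%VS = <<[:: x; p]>>%VS.
Proof. by apply: eq_span => z; rewrite !inE orbC. Qed.

End SpanFacts.

(** * Consequences of the alternating laws *)

Section Alternating.
Variables (K : fieldType) (vT : vectType K) (T : vT -> vT -> vT -> K).
Hypothesis altT : alternating3 T.

Lemma alt3_diag23 p x : T p x x = 0.
Proof.
by rewrite (alt3_swap12 altT) (alt3_swap23 altT) (alt3_diag altT) !oppr0.
Qed.

Lemma alt3_diag13 p x : T p x p = 0.
Proof. by rewrite (alt3_swap23 altT) (alt3_diag altT) oppr0. Qed.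

Lemma alt3_linear2 p y a x z : T p (a *: x + z) y = a * T p x y + T p z y.
Proof.
rewrite (alt3_swap23 altT) (alt3_linear altT) (alt3_swap23 altT p x).
by rewrite (alt3_swap23 altT p z); ring.
Qed.

Lemma alt3_scale2 p y a x : T p (a *: x) y = a * T p x y.
Proof.
have T0 : T p 0 y = 0.
  by have := alt3_linear2 p y (-1) 0 0; rewrite scaler0 addr0 mulN1r addNr.
by rewrite -[a *: x]addr0 alt3_linear2 T0 addr0.
Qed.

Lemma alt3_linear1 x y a p z : T (a *: p + z) x y = a * T p x y + T z x y.
Proof.
rewrite (alt3_swap12 altT) alt3_linear2 (alt3_swap12 altT p).
by rewrite (alt3_swap12 altT z); ring.
Qed.

Lemma alt3_scale1 x y a p : T (a *: p) x y = a * T p x y.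
Proof. by rewrite (alt3_swap12 altT) alt3_scale2 (alt3_swap12 altT p) mulrN. Qed.

Lemma alt3_dependent p x y : y \in <<[:: p; x]>>%VS -> T p x y = 0.
Proof.
apply: (linear_eq0_span (alt3_linear altT p x)) => z; rewrite !inE.
by case/orP=> /eqP ->; rewrite ?alt3_diag13 ?alt3_diag23.
Qed.

Lemma alt3_eq0_seq (s : seq vT) :
  (forall u v w, u \in s -> v \in s -> w \in s -> T u v w = 0) ->
  forall u v w, u \in <<s>>%VS -> v \in <<s>>%VS -> w \in <<s>>%VS -> T u v w = 0.
Proof.
move=> T0 u v w us vs ws.
apply: (linear_eq0_span (alt3_linear1 v w) _ us) => u' u's.
apply: (linear_eq0_span (alt3_linear2 u' w) _ vs) => v' v's.
apply: (linear_eq0_span (alt3_linear altT u' v') _ ws) => w' w's.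
exact: T0.
Qed.

(** Makes the vanishing of [T] on a plane independent of the spanning triple: on generators, each
    value is zero by repetition or is [T p x y] up to sign. *)
Lemma alt3_eq0_span3 p x y : T p x y = 0 ->
  forall u v w, u \in <<[:: p; x; y]>>%VS -> v \in <<[:: p; x; y]>>%VS ->
    w \in <<[:: p; x; y]>>%VS -> T u v w = 0.
Proof.
move=> T0; apply: alt3_eq0_seq => u v w; rewrite !inE.
have T1 : T x p y = 0 by rewrite (alt3_swap12 altT) T0 oppr0.
have T2 : T p y x = 0 by rewrite (alt3_swap23 altT) T0 oppr0.
have T3 : T x y p = 0 by rewrite (alt3_swap23 altT) T1 oppr0.
have T4 : T y p x = 0 by rewrite (alt3_swap12 altT) T2 oppr0.
have T5 : T y x p = 0 by rewrite (alt3_swap23 altT) T4 oppr0.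
by do 3!case/or3P=> /eqP ->;
  rewrite ?(alt3_diag altT) ?alt3_diag23 ?alt3_diag13.
Qed.

End Alternating.

(** * Line partitions *)

Section LinePartition.
Variables (F : fieldType) (n : nat).
Notation V := 'rV[F]_(n.+1).
Notation Sub := {vspace V}.
Variable Om : (Sub -> Prop) -> Prop.
Hypothesis hn : (2 <= n)%N.
Hypothesis partOm : line_partition Om.
Implicit Types (p x y z v : V) (l e H : Sub).

Lemma dim_full : \dim {:V} = n.+1.
Proof. by rewrite dimvf dim_matrix [LHS]mul1n. Qed.

Lemma is_point_line p : p != 0 -> is_point <[p]>%VS.
Proof. by rewrite /is_point dim_vline => ->. Qed.

Lemma is_line_span p x : free [:: p; x] -> is_line <<[:: p; x]>>%VS.
Proof. by move/eqP. Qed.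

Lemma is_plane_span p x y : free [:: p; x; y] -> is_plane <<[:: p; x; y]>>%VS.
Proof. by move/eqP. Qed.

(** Each point of [H0] lies on a line of the spread, and that line lies in [H]. *)
Lemma spread_sub H0 H C :
  line_spread H0 C -> (forall m, C m -> (m <= H)%VS) -> (H0 <= H)%VS.
Proof.
move=> [_ cover] CH; apply/subvP=> v vH0.
have [->|v0] := eqVneq v 0; first exact: mem0v.
have [m [[Cm vm] _]] := cover _ (is_point_line v0) vH0.
exact: subv_trans vm (CH m Cm).
Qed.

(** Bridges [pi_rel], which only asks that the class lie in [H], and the partition axiom, which
    spreads some hyperplane: the two have equal dimension. *)
Lemma class_spread C H : Om C -> is_hyperplane H ->
  (forall m, C m -> (m <= H)%VS) -> line_spread H C.
Proof.
move=> OmC hH CH; have [/(_ _ OmC)[H0 [hH0 sp]] _] := partOm.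
have -> // : H = H0.
by apply/esym/eqP; rewrite eqEdim (spread_sub sp CH) hH0 hH /=.
Qed.

Lemma pi_exists l : is_line l -> exists H, pi_rel Om l H.
Proof.
move=> ll; have [hyp [/(_ _ ll)[C [[OmC Cl] _]] _]] := partOm.
have [H [hH sp]] := hyp _ OmC; exists H; split=> //; exists C; split=> //.
by split=> // m /(proj1 sp)[].
Qed.

Lemma pi_line l H : pi_rel Om l H -> is_line l.
Proof.
by case=> hH [C [OmC [Cl CH]]]; have [/(_ _ Cl)[]] := class_spread OmC hH CH.
Qed.

Lemma pi_unique l H H' : pi_rel Om l H -> pi_rel Om l H' -> H = H'.
Proof.
move=> piH piH'; have ll := pi_line piH.
have [_ [/(_ _ ll)[C0 [_ C0u]] _]] := partOm.
case: piH piH' => hH [C [OmC [Cl CH]]] [hH' [C' [OmC' [C'l C'H']]]].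
have CC' : C = C' by rewrite -(C0u C) // -(C0u C').
apply/eqP; rewrite eqEdim hH hH' leqnn andbT.
by apply: spread_sub (class_spread OmC hH CH) _; rewrite CC'.
Qed.

Lemma pi_sub l H : pi_rel Om l H -> (l <= H)%VS.
Proof. by case=> _ [C [_ [Cl]]]; apply. Qed.

(** Lines with the same hyperplane are in the same class, and a spread has only one line through the
    point [p]. *)
Lemma pi_inj p l l' H : p != 0 -> p \in l -> p \in l' ->
  pi_rel Om l H -> pi_rel Om l' H -> l = l'.
Proof.
move=> p0 pl pl' piH piH'; have pH : p \in H := subvP (pi_sub piH) _ pl.
case: piH piH' => hH [C [OmC [Cl CH]]] [_ [C' [OmC' [C'l' C'H]]]].
have [_ [_ /(_ _ hH)[C0 [_ C0u]]]] := partOm.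
have CC' : C = C' by rewrite -(C0u C) // -(C0u C').
have [_ /(_ _ (is_point_line p0) pH)[l0 [_ l0u]]] := class_spread OmC hH CH.
by rewrite -(l0u l) // -(l0u l') // CC'.
Qed.

Lemma pi_injP p x y H : free [:: p; x; y] ->
  pi_rel Om <<[:: p; x]>>%VS H -> ~ pi_rel Om <<[:: p; y]>>%VS H.
Proof.
move=> fr px py; have p0 : p != 0 by apply: (free_not0 fr); rewrite mem_head.
have e : <<[:: p; x]>>%VS = <<[:: p; y]>>%VS.
  by apply: (pi_inj p0) px py; rewrite memv_span ?mem_head.
move: fr; rewrite free3_notin e => /andP[/negP[]].
by rewrite memv_span // !inE eqxx orbT.
Qed.

End LinePartition.
(** The middle term of the equivalence: each implication first produces such a form and then reads
    the other side off it. *)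
Definition represents (F : fieldType) (n : nat)
    (Om : ({vspace 'rV[F]_(n.+1)} -> Prop) -> Prop)
    (T : 'rV[F]_(n.+1) -> 'rV[F]_(n.+1) -> 'rV[F]_(n.+1) -> F) :=
  alternating3 T /\ forall p x H, free [:: p; x] -> pi_rel Om <<[:: p; x]>>%VS H ->
    forall y, (T p x y == 0) = (y \in H).

(** * What a representing form says about planes, lines and pencils *)

Section Represented.
Variables (F : fieldType) (n : nat).
Notation V := 'rV[F]_(n.+1).
Notation Sub := {vspace V}.
Variable Om : (Sub -> Prop) -> Prop.
Hypothesis hn : (2 <= n)%N.
Hypothesis partOm : line_partition Om.
Variable T : V -> V -> V -> F.
Hypothesis repT : represents Om T.

Let altT : alternating3 T := proj1 repT.

Lemma represents_neq0 p x : free [:: p; x] -> exists y, T p x y != 0.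
Proof.
move=> fr; have [H piH] := pi_exists partOm (is_line_span fr).
have [y _ yH] : exists2 y, y \in {:V}%VS & y \notin H.
  by apply: exists_mem_notin; rewrite dim_full (proj1 piH).
by exists y; rewrite (proj2 repT _ _ _ fr piH).
Qed.

(** One line of the plane with the required property forces [T] to vanish on a basis, hence on the
    whole plane; then every line of the plane has the property. *)
Lemma represents_K e : K_of Om e <-> is_plane e /\
  (forall u v w, u \in e -> v \in e -> w \in e -> T u v w = 0).
Proof.
split=> [[pe [l [H [ll [piH [le eH]]]]]]|[pe Te]].
  split=> //; have [p [x [el fr]]] := dim2_span ll; subst l.
  have pe' : p \in e by apply: (subvP le); rewrite memv_span ?mem_head.
  have xe' : x \in e by apply: (subvP le); rewrite memv_span // !inE eqxx orbT.
  have [y [ee fr3]] := extend_dim3 fr pe' xe' pe.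
  suff T0 : T p x y = 0 by move=> u v w; rewrite ee; apply: alt3_eq0_span3.
  apply/eqP; rewrite (proj2 repT _ _ _ fr piH); apply: (subvP eH).
  by rewrite ee memv_span // !inE eqxx !orbT.
split=> //; have [p [x [y [ee fr]]]] := dim3_span pe.
have fr2 : free [:: p; x] by free_from fr.
have ll := is_line_span fr2; have [H piH] := pi_exists partOm ll.
have mem_e z : z \in [:: p; x; y] -> z \in e by rewrite ee; apply: memv_span.
exists <<[:: p; x]>>%VS, H; split=> //; split=> //; split.
  by apply/span_subvP=> z; rewrite !inE => /orP[] /eqP ->; apply: mem_e;
    rewrite !inE eqxx ?orbT.
apply/subvP=> z ze; rewrite -(proj2 repT _ _ _ fr2 piH) Te //;
  by apply: mem_e; rewrite !inE eqxx ?orbT.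
Qed.

(** A vector [y] with [T p x y] nonzero spans with the line a plane outside the complex. *)
Lemma represents_no_singular_line l : ~ singular_line (K_of Om) l.
Proof.
move=> [ll sing]; have [p [x [el fr]]] := dim2_span ll.
have [y Ty] := represents_neq0 fr.
have yl : y \notin <<[:: p; x]>>%VS.
  by apply: contra Ty => /(alt3_dependent altT) ->.
have fr3 : free [:: p; x; y] by rewrite free3_notin yl.
have le : (l <= <<[:: p; x; y]>>)%VS.
  by rewrite el; apply: sub_span => z; rewrite !inE => /orP[] ->; rewrite ?orbT.
have /represents_K[_ T0] := sing _ (is_plane_span fr3) le.
by case/eqP: Ty; apply: T0; rewrite memv_span // !inE eqxx ?orbT.
Qed.

(** The axis of the pencil of hyperplanes is the intersection of the hyperplanes of two lines of the
    pencil; linearity of [T p] puts it in all the others. *)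
Lemma represents_linear_partition : linear_partition Om.
Proof.
move=> p0 e pp pe p0e.
set p := vpick p0; have pne : p != 0 by rewrite vpick0 -dimv_eq0 pp.
have p0E : p0 = <[p]>%VS.
  by apply/esym/eqP; rewrite eqEdim -memvE memv_pick dim_vline pne pp.
have pin : p \in e by apply: (subvP p0e); apply: memv_pick.
have [x xe xp] : exists2 x, x \in e & x \notin p0.
  by apply: exists_mem_notin; rewrite pp pe.
have frpx : free [:: p; x].
  by rewrite free2C free_cons span_seq1 -p0E xp seq1_free.
have [y [ee fr]] := extend_dim3 frpx pin xe pe.
have frpy : free [:: p; y] by free_from fr.
have lt_n : (n - 1 < n)%N by lia.
have [H1 pi1] := pi_exists partOm (is_line_span frpx).
have [H2 pi2] := pi_exists partOm (is_line_span frpy).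
have h1 := proj1 pi1; have h2 := proj1 pi2.
have H12 : H1 != H2.
  by apply/eqP=> E; move: pi2; rewrite -E; apply: (pi_injP partOm fr).
have T1 := proj2 repT _ _ _ frpx pi1; have T2 := proj2 repT _ _ _ frpy pi2.
have dS : \dim (H1 :&: H2) = (n - 1)%N.
  have := dimv_sum_cap H1 H2; rewrite h1 h2.
  have lt : (n < \dim (H1 + H2))%N.
    rewrite ltnNge; apply: contra H12 => le.
    have E1 : H1 = (H1 + H2)%VS by apply/eqP; rewrite eqEdim addvSl h1.
    have E2 : H2 = (H1 + H2)%VS by apply/eqP; rewrite eqEdim addvSr h2.
    exact/eqP/(etrans E1 (esym E2)).
  have := dimvS (subvf (H1 + H2)%VS); rewrite dim_full => le.
  have -> : \dim (H1 + H2) = n.+1 by apply/eqP; rewrite eqn_leq le.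
  clear; lia.
have pencil l : in_pencil p0 e l ->
    exists v, l = <<[:: p; v]>>%VS /\ free [:: p; v] /\ v \in e.
  move=> [ll [p0l le]]; have pl : p \in l by apply: (subvP p0l); apply: memv_pick.
  have [v [lv frv]] := extend_dim2 pne pl ll.
  exists v; split=> //; split=> //; apply: (subvP le).
  by rewrite lv memv_span // !inE eqxx orbT.
exists (H1 :&: H2)%VS; split=> //; split; [|split].
- move=> l H /pencil[v [-> [frv ve]]] piH; apply/subvP=> z /memv_capP[].
  rewrite -T1 -T2 -(proj2 repT _ _ _ frv piH) => /eqP xz /eqP yz; apply/eqP.
  rewrite ee in ve; apply: (linear_eq0_span (alt3_linear2 altT p z)) ve.
  by move=> w; rewrite !inE => /or3P[] /eqP -> //; apply: (alt3_diag altT).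
- move=> H hH SH.
  have [w wH wS] : exists2 w, w \in H & w \notin (H1 :&: H2)%VS.
    by apply: exists_mem_notin; rewrite dS hH.
  (* The line of the pencil sought is spanned by [p] and the combination [v] of
     [x] and [y] annihilated by [T p _ w]. *)
  pose v := T p y w *: x + - T p x w *: y.
  have Tvw : T p v w = 0.
    by rewrite /v (alt3_linear2 altT) (alt3_scale2 altT); ring.
  have ve : v \in e by rewrite memvD ?memvZ // ee memv_span // !inE eqxx ?orbT.
  (* Were [v] a multiple of [p], the functional [T p v] would vanish. Evaluating it on [H1] outside
     [H2], and on [H2] outside [H1], would give [T p x w = T p y w = 0], contrary to the choice of
     [w]. *)
  have frv : free [:: p; v].
    rewrite free2C free_cons seq1_free pne andbT span_seq1.
    apply: contra wS => /vlineP[k vk].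
    have Tv z : T p y w * T p x z - T p x w * T p y z = 0.
      have : T p v z = 0 by rewrite vk (alt3_scale2 altT) (alt3_diag altT) mulr0.
      by rewrite /v (alt3_linear2 altT) (alt3_scale2 altT) mulNr.
    have [z zH1 zS] : exists2 z, z \in H1 & z \notin (H1 :&: H2)%VS.
      by apply: exists_mem_notin; rewrite dS h1.
    have [t tH2 tS] : exists2 t, t \in H2 & t \notin (H1 :&: H2)%VS.
      by apply: exists_mem_notin; rewrite dS h2.
    rewrite memv_cap zH1 /= -T2 in zS; rewrite -T1 in zH1.
    rewrite memv_cap tH2 andbT -T1 in tS; rewrite -T2 in tH2.
    rewrite memv_cap -T1 -T2; apply/andP; split.
      move/eqP: (Tv z); rewrite (eqP zH1) mulr0 sub0r oppr_eq0 mulf_eq0.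
      by rewrite (negPf zS) orbF.
    move/eqP: (Tv t); rewrite (eqP tH2) mulr0 subr0 mulf_eq0.
    by rewrite (negPf tS) orbF.
  have [H' piH'] := pi_exists partOm (is_line_span frv).
  have TH' := proj2 repT _ _ _ frv piH'.
  have S' : (H1 :&: H2 <= H')%VS.
    apply/subvP=> z; rewrite memv_cap -T1 -T2 -TH' => /andP[/eqP xz /eqP yz].
    by rewrite /v (alt3_linear2 altT) (alt3_scale2 altT) xz yz !mulr0 addr0.
  exists <<[:: p; v]>>%VS; split.
    split; first exact: is_line_span.
    split; first by rewrite p0E -memvE memv_span ?mem_head.
    by apply/span_subvP=> z; rewrite !inE => /orP[] /eqP ->.
  have HE : H = (<[w]> + (H1 :&: H2))%VS.
    apply/esym/eqP; rewrite eqEdim subv_add -memvE wH SH /= hH dim_add_line // dS.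
    by rewrite subn1 prednK // (ltn_trans _ hn).
  have HH' : (H <= H')%VS by rewrite HE subv_add S' -memvE -TH' Tvw eqxx.
  suff -> : H = H' by [].
  by apply/eqP; rewrite eqEdim HH' hH (proj1 piH') /=.
- move=> l l' H [_ [pl _]] [_ [pl' _]] piH piH'.
  apply: (pi_inj partOm pne) piH piH'; first exact: (subvP pl _ (memv_pick _)).
  exact: (subvP pl' _ (memv_pick _)).
Qed.

End Represented.
(** * Plucker coordinates *)

Section PluckerForm.
Variables (F : fieldType) (n : nat).
Notation V := 'rV[F]_(n.+1).
Implicit Types (p x y : V) (i j k : 'I_n.+1) (c : 'I_n.+1 -> 'I_n.+1 -> 'I_n.+1 -> F).

Lemma pluckerE p x y i j k : plucker [tuple p; x; y] i j k =
  p 0 i * x 0 j * y 0 k - p 0 i * x 0 k * y 0 j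
  - p 0 j * x 0 i * y 0 k + p 0 j * x 0 k * y 0 i
  + p 0 k * x 0 i * y 0 j - p 0 k * x 0 j * y 0 i.
Proof.
rewrite /plucker (expand_det_row _ ord0) !big_ord_recl big_ord0 /cofactor.
rewrite !(expand_det_row _ ord0) !big_ord_recl !big_ord0 /cofactor !det_mx11 !mxE.
rewrite !(tnth_nth 0) /= /bump /=; ring.
Qed.

Lemma plucker_form_alternating c :
  alternating3 (fun p x y => plucker_form c [tuple p; x; y]).
Proof.
split=> [p x a y z|p x y|p x y|p y].
- rewrite /plucker_form mulr_sumr -big_split; apply: eq_bigr => i _ /=.
  rewrite mulr_sumr -big_split; apply: eq_bigr => j _ /=.
  rewrite mulr_sumr -big_split; apply: eq_bigr => k _ /=.
  by rewrite !pluckerE !mxE; ring.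
- rewrite /plucker_form -sumrN; apply: eq_bigr => i _.
  rewrite -sumrN; apply: eq_bigr => j _.
  by rewrite -sumrN; apply: eq_bigr => k _; rewrite !pluckerE; ring.
- rewrite /plucker_form -sumrN; apply: eq_bigr => i _.
  rewrite -sumrN; apply: eq_bigr => j _.
  by rewrite -sumrN; apply: eq_bigr => k _; rewrite !pluckerE; ring.
- rewrite /plucker_form big1 // => i _; rewrite big1 // => j _.
  by rewrite big1 // => k _; rewrite pluckerE; ring.
Qed.

(** Both index triples increase, so of the six determinant terms only that of the identity
    permutation can survive. *)
Lemma plucker_delta (a b d i j k : 'I_n.+1) :
  (a < b)%N -> (b < d)%N -> (i < j)%N -> (j < k)%N ->
  plucker [tuple delta_mx 0 a; delta_mx 0 b; delta_mx 0 d] i j k =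
    [&& i == a, j == b & k == d]%:R :> F.
Proof.
move=> ab bd ij jk; rewrite pluckerE !mxE !eqxx /=.
have mulb3 (u v w : bool) : u%:R * v%:R * w%:R = [&& u, v & w]%:R :> F.
  by case: u; case: v; case: w; rewrite ?mul0r ?mulr0 ?mulr1.
rewrite !mulb3.
have -> : [&& i == a, k == b & j == d] = false.
  by apply/negP=> /and3P[/eqP ? /eqP ? /eqP ?]; subst; lia.
have -> : [&& j == a, i == b & k == d] = false.
  by apply/negP=> /and3P[/eqP ? /eqP ? /eqP ?]; subst; lia.
have -> : [&& j == a, k == b & i == d] = false.
  by apply/negP=> /and3P[/eqP ? /eqP ? /eqP ?]; subst; lia.
have -> : [&& k == a, i == b & j == d] = false.
  by apply/negP=> /and3P[/eqP ? /eqP ? /eqP ?]; subst; lia.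
have -> : [&& k == a, j == b & i == d] = false.
  by apply/negP=> /and3P[/eqP ? /eqP ? /eqP ?]; subst; lia.
by rewrite !subr0 !addr0.
Qed.

Lemma plucker_form_delta c (a b d : 'I_n.+1) : (a < b)%N -> (b < d)%N ->
  plucker_form c [tuple delta_mx 0 a; delta_mx 0 b; delta_mx 0 d] = c a b d.
Proof.
move=> ab bd; rewrite /plucker_form.
rewrite (bigD1 a) //= [X in _ + X]big1 ?addr0; last first.
  move=> i ia; rewrite big1 // => j _; rewrite big1 // => k /andP[ij jk].
  by rewrite plucker_delta // (negPf ia) mulr0.
rewrite (bigD1 b) //= [X in _ + X]big1 ?addr0; last first.
  move=> j jb; rewrite big1 // => k /andP[ij jk].
  by rewrite plucker_delta // (negPf jb) andbF mulr0.
rewrite (bigD1 d) ?ab //= big1 ?addr0; last first.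
  move=> k /andP[jk kd].
  by rewrite plucker_delta // (negPf kd) !andbF mulr0.
by rewrite plucker_delta // !eqxx mulr1.
Qed.

(** Reduce to basis vectors, then sort the indices by swaps; a repeated index gives zero. *)
Lemma alternating3_eq0 (T : V -> V -> V -> F) : alternating3 T ->
  (forall i j k, (i < j)%N -> (j < k)%N ->
     T (delta_mx 0 i) (delta_mx 0 j) (delta_mx 0 k) = 0) ->
  forall p x y, T p x y = 0.
Proof.
move=> altT T0 p x y.
have full (u : V) : u \in <<[seq (delta_mx 0%R i : V) | i <- enum 'I_n.+1]>>%VS.
  rewrite (row_sum_delta u); apply: memv_suml => i _; apply/memvZ/memv_span.
  by apply: map_f; rewrite mem_enum.
apply: (alt3_eq0_seq altT) (full p) (full x) (full y).
move=> _ _ _ /mapP[i _ ->] /mapP[j _ ->] /mapP[k _ ->].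
have s12 := alt3_swap12 altT; have s23 := alt3_swap23 altT.
have [ij|ji|/val_inj ->] := ltngtP i j; last exact: (alt3_diag altT).
  have [jk|kj|/val_inj ->] := ltngtP j k; last exact: (alt3_diag23 altT).
    exact: T0.
  have [ik|ki|/val_inj ->] := ltngtP i k; last exact: (alt3_diag13 altT).
    by rewrite s23 T0 ?oppr0.
  by rewrite s23 s12 T0 ?oppr0.
have [ik|ki|/val_inj ->] := ltngtP i k; last exact: (alt3_diag13 altT).
  by rewrite s12 T0 ?oppr0.
have [jk|kj|/val_inj ->] := ltngtP j k; last exact: (alt3_diag23 altT).
  by rewrite s12 s23 T0 ?oppr0.
by rewrite s12 s23 s12 T0 ?oppr0.
Qed.

(** The difference of the two sides is alternating and vanishes on increasing basis triples. *)
Lemma alternating3_plucker_form (T : V -> V -> V -> F) : alternating3 T ->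
  forall p x y, plucker_form (fun i j k =>
    T (delta_mx 0 i) (delta_mx 0 j) (delta_mx 0 k)) [tuple p; x; y] = T p x y.
Proof.
move=> altT p x y; set c := fun i j k => _; apply/eqP; rewrite -subr_eq0; apply/eqP.
have altc := plucker_form_alternating c.
move: p x y; apply: (@alternating3_eq0
  (fun p x y => plucker_form c [tuple p; x; y] - T p x y)) => [|i j k ij jk]; last first.
  by rewrite plucker_form_delta // subrr.
split=> [p x a y z|p x y|p x y|p y].
- by rewrite (alt3_linear altc) (alt3_linear altT); ring.
- by rewrite (alt3_swap23 altc) (alt3_swap23 altT); ring.
- by rewrite (alt3_swap12 altc) (alt3_swap12 altT); ring.
- by rewrite (alt3_diag altc) (alt3_diag altT) subrr.
Qed.

Lemma tuple3E (X : Type) (t : 3.-tuple X) : exists a b d, t = [tuple a; b; d].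
Proof.
case: t => [[|a [|b [|d [|]]]] // sz].
by exists a, b, d; apply: val_inj.
Qed.

End PluckerForm.

(** * Linear partitions and linear complexes *)

Section LinearPartitions.
Variables (F : fieldType) (n : nat).
Notation V := 'rV[F]_(n.+1).
Notation Sub := {vspace V}.
Variable Om : (Sub -> Prop) -> Prop.
Hypothesis hn : (2 <= n)%N.
Hypothesis partOm : line_partition Om.

Lemma represents_linear_complex (T : V -> V -> V -> F) :
  represents Om T -> linear_complex (K_of Om).
Proof.
move=> repT; have altT := proj1 repT.
exists (fun i j k => T (delta_mx 0 i) (delta_mx 0 j) (delta_mx 0 k)).
split.
  (* If all coefficients were zero then [T] would be zero, but [T p x] is nonzero for any
     independent [p] and [x]. *)
  apply: contrapT => no; have T0 : forall p x y, T p x y = 0.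
    apply: (alternating3_eq0 altT) => i j k ij jk; apply/eqP.
    by apply/negPn/negP=> nz; apply: no; exists i, j, k.
  have [|p pn] := @exists_notin_span _ V [::]; first by rewrite dim_full.
  have [|x xp] := @exists_notin_span _ V [:: p]; first by rewrite dim_full ltnS ltnW.
  have frpx : free [:: p; x].
    rewrite free2C free_cons xp seq1_free -memv0 -span_nil; exact: pn.
  by have [z] := represents_neq0 partOm repT frpx; rewrite T0 eqxx.
move=> e; rewrite (represents_K partOm repT); split=> [[pe Te]|[pe [t [et Tt]]]].
  split=> //; have [p [x [y [ee fr]]]] := dim3_span pe.
  exists [tuple p; x; y]; split=> //.
  by rewrite alternating3_plucker_form // Te // ee memv_span // !inE eqxx ?orbT.
split=> //; have [p [x [y tE]]] := tuple3E t; subst t.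
rewrite (alternating3_plucker_form altT) in Tt.
by rewrite et; apply: (alt3_eq0_span3 altT).
Qed.

Lemma linear_complex_represents : linear_complex (K_of Om) ->
  exists T, represents Om T.
Proof.
move=> [c [[i0 [j0 [k0 [ij jk c0]]]] Kc]].
pose T p x y := plucker_form c [tuple p; x; y].
have altT : alternating3 T by apply: plucker_form_alternating.
(* For [y] in [H] off the line, the plane spanned by [p], [x], [y] lies between the line and [H], so
   it belongs to the complex. *)
have TK p x H : free [:: p; x] -> pi_rel Om <<[:: p; x]>>%VS H ->
    forall y, y \in H -> T p x y = 0.
  move=> fr piH y yH.
  have [|yl] := boolP (y \in <<[:: p; x]>>%VS); first exact: alt3_dependent.
  have fr3 : free [:: p; x; y] by rewrite free3_notin yl.
  have /Kc[_ [t [et Tt]]] : K_of Om <<[:: p; x; y]>>%VS.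
    split; first exact: is_plane_span.
    exists <<[:: p; x]>>%VS, H; split; first exact: is_line_span.
    split=> //; split.
      by apply: sub_span => z; rewrite !inE => /orP[] ->; rewrite ?orbT.
    have lH := subvP (pi_sub piH).
    apply/span_subvP=> z; rewrite !inE => /or3P[] /eqP -> //; apply: lH;
      by rewrite memv_span // !inE eqxx ?orbT.
  have [a [b [d tE]]] := tuple3E t; subst t.
  apply: (alt3_eq0_span3 altT Tt); rewrite -et memv_span // !inE eqxx ?orbT //.
have Tneq0 : exists p x y, T p x y != 0.
  exists (delta_mx 0 i0), (delta_mx 0 j0), (delta_mx 0 k0).
  by rewrite /T plucker_form_delta.
have kerT p x H w : free [:: p; x] -> pi_rel Om <<[:: p; x]>>%VS H -> T p x w != 0 ->
    forall y, (T p x y == 0) = (y \in H).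
  move=> fr piH; apply: linear_eq0_hyperplane (alt3_linear altT p x) (TK _ _ _ fr piH) _.
  by rewrite dim_full (proj1 piH).
(* If [T p x] vanishes then [T p (x + y) = T p y], so injectivity of the map at
   the point [p] forces [T p y = 0]. *)
have spread p x : free [:: p; x] -> (forall z, T p x z = 0) -> forall y z, T p y z = 0.
  move=> fr Tpx y z; have [fr3|nf] := boolP (free [:: p; x; y]); last first.
    rewrite (alt3_swap23 altT).
    have : y \in <<[:: p; x]>>%VS.
      by apply: contraR nf => yl; rewrite free3_notin yl.
    move=> yl; apply/eqP; rewrite oppr_eq0; apply/eqP.
    apply: (linear_eq0_span (alt3_linear altT p z)) yl => u; rewrite !inE.
    case/orP=> /eqP ->; first exact: (alt3_diag13 altT).
    by rewrite (alt3_swap23 altT) Tpx oppr0.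
  apply/eqP/negPn/negP=> nz.
  have Txy t : T p (x + y) t = T p y t.
    by rewrite -[x]scale1r (alt3_linear2 altT) Tpx mulr0 add0r.
  have fry : free [:: p; y] by free_from fr3.
  have fr3' : free [:: p; y; x + y].
    have : free [:: p; y; x] by free_from fr3.
    rewrite !free3_notin => /andP[xl _]; rewrite fry andbT rpredDr //.
    by rewrite memv_span // !inE eqxx orbT.
  have frxy : free [:: p; x + y] by free_from fr3'.
  have [H piH] := pi_exists partOm (is_line_span fry).
  have [H' piH'] := pi_exists partOm (is_line_span frxy).
  have HH' : H = H'.
    apply/vspaceP=> t; rewrite -(kerT _ _ _ _ fry piH nz) -Txy.
    by apply: kerT frxy piH' _ t; rewrite Txy; apply: nz.
  by apply: (pi_injP partOm fr3' piH); rewrite HH'.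
have nonzero p x : free [:: p; x] -> exists w, T p x w != 0.
  move=> fr; apply: contrapT => no.
  have Tpx z : T p x z = 0 by apply/eqP/negPn/negP=> nz; apply: no; exists z.
  (* Once [T p] vanishes, so does [T q p] for every [q]; applying [spread] at [q] kills [T q], and a
     [q] proportional to [p] is killed directly. *)
  have Tp := spread _ _ fr Tpx.
  have [q [u [v]]] := Tneq0; case/eqP.
  have [frq|nf] := boolP (free [:: q; p]).
    by apply: (spread q p) => // t; rewrite (alt3_swap12 altT) Tp oppr0.
  have p0 : free [:: p] by free_from fr.
  have := mem_span_dependent p0 nf.
  by rewrite span_seq1 => /vlineP[a ->]; rewrite (alt3_scale1 altT) Tp mulr0.
exists T; split=> // p x H fr piH; have [w nz] := nonzero p x fr.
exact: kerT fr piH nz.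
Qed.

(* In a plane every line is its own class, and the determinant serves as form. *)
Lemma linear_partition_represents_plane : n = 2%N -> exists T, represents Om T.
Proof.
move=> n2; pose T (p x y : V) := plucker_form (fun _ _ _ => 1 : F) [tuple p; x; y].
have altT : alternating3 T := plucker_form_alternating _.
exists T; split=> // p x H fr piH y.
have -> : H = <<[:: p; x]>>%VS.
  by apply: free_span_eq => //; [apply: pi_sub piH | exact: etrans (proj1 piH) n2].
apply/eqP/idP=> [T0|]; last exact: (alt3_dependent altT).
apply: contraT => yl; have fr3 : free [:: p; x; y] by rewrite free3_notin yl.
have full : <<[:: p; x; y]>>%VS = fullv.
  apply/esym/free_span_eq; rewrite ?subvf //.
  by rewrite dim_full; congr _.+1.
(* The form takes the value 1 on the first three basis vectors, whereas a zero on a spanning triple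
   would make it vanish identically. *)
have := plucker_form_delta (fun _ _ _ => 1 : F)
  (a := inord 0) (b := inord 1) (d := inord 2 : 'I_n.+1).
have lt2 : (2 < n.+1)%N by [].
have lt1 : (1 < n.+1)%N := ltnW lt2.
rewrite (inordK (ltnW lt1)) (inordK lt1) (inordK lt2) => /(_ isT isT) T1.
have /eqP := oner_neq0 F; case; rewrite -T1.
by apply: (alt3_eq0_span3 altT T0); rewrite full memvf.
Qed.

Lemma linear_partition_represents : linear_partition Om -> exists T, represents Om T.
Proof.
move=> linOm.
(* The cocycle argument at a point needs vector dimension at least four, so the projective plane is
   treated apart. *)
have [n2|n3] := eqVneq n 2%N; first exact: linear_partition_represents_plane.
have choose_f (u : V * V) : exists f : 'Hom(V, F^o),
    free [:: u.1; u.2] -> f != 0 /\ pi_rel Om <<[:: u.1; u.2]>>%VS (lker f).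
  have [fr|nf] := boolP (free [:: u.1; u.2]); last by exists 0.
  have [H piH] := pi_exists partOm (is_line_span fr).
  have [|f [f0 fH]] := @exists_functional _ _ H; first by rewrite dim_full (proj1 piH).
  by exists f => _; rewrite fH.
have [f' fP] := choice choose_f; pose f p x := f' (p, x).
have f0 p x : free [:: p; x] -> f p x != 0 by move=> /(fP (p, x))[].
have fpi p x : free [:: p; x] -> pi_rel Om <<[:: p; x]>>%VS (lker (f p x)).
  by move=> /(fP (p, x))[].
have pencil_span p x y z : free [:: p; z] -> z \in <<[:: p; x; y]>>%VS ->
    in_pencil <[p]>%VS <<[:: p; x; y]>>%VS <<[:: p; z]>>%VS.
  move=> fr ze; split; first exact: is_line_span.
  split; first by rewrite -memvE memv_span ?mem_head.
  by apply/span_subvP=> u; rewrite !inE => /orP[] /eqP -> //; rewrite memv_span ?mem_head.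
(* The axis given by linearity is the intersection of two distinct kernels. A line through [p] whose
   hyperplane contains it lies in the plane: surjectivity supplies a line of the pencil with that
   hyperplane, and injectivity at [p] identifies the two. *)
have pencil_base p x y : free [:: p; x; y] -> exists S : Sub,
    [/\ S = (lker (f p x) :&: lker (f p y))%VS,
      forall z, free [:: p; z] -> z \in <<[:: p; x; y]>>%VS -> (S <= lker (f p z))%VS
    & forall z, free [:: p; z] -> (S <= lker (f p z))%VS -> z \in <<[:: p; x; y]>>%VS].
  move=> fr; have p0 : p != 0 by apply: (free_not0 fr); rewrite mem_head.
  have pe : (<[p]> <= <<[:: p; x; y]>>)%VS by rewrite -memvE memv_span ?mem_head.
  have [S [dS [S1 [S2 _]]]] := linOm _ _ (is_point_line p0) (is_plane_span fr) pe.
  have frx : free [:: p; x] by free_from fr.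
  have fry : free [:: p; y] by free_from fr.
  have S1' z : free [:: p; z] -> z \in <<[:: p; x; y]>>%VS -> (S <= lker (f p z))%VS.
    by move=> frz ze; apply: S1 (fpi _ _ frz); apply: pencil_span.
  exists S; split=> //.
    apply/eqP; rewrite eqEdim subv_cap !S1' //=; try by rewrite memv_span // !inE eqxx ?orbT.
    rewrite dS; have hx := proj1 (fpi _ _ frx); have hy := proj1 (fpi _ _ fry).
    suff : (\dim (lker (f p x) :&: lker (f p y)) < n)%N.
      by rewrite leq_subRL ?(ltnW hn) // add1n.
    rewrite ltnNge; apply/negP=> le; apply: (pi_injP partOm fr (fpi _ _ frx)).
    suff <- : lker (f p y) = lker (f p x) by apply: fpi.
    have E1 : (lker (f p x) :&: lker (f p y))%VS = lker (f p x).
      by apply/eqP; rewrite eqEdim capvSl hx.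
    have E2 : (lker (f p x) :&: lker (f p y))%VS = lker (f p y).
      by apply/eqP; rewrite eqEdim capvSr hy.
    exact: etrans (esym E2) E1.
  move=> z frz Sz; have [l [[ll [pl le]] pil]] := S2 _ (proj1 (fpi _ _ frz)) Sz.
  apply: (subvP le).
  have -> : l = <<[:: p; z]>>%VS.
    apply: (pi_inj partOm p0) pil (fpi _ _ frz); first by rewrite memvE.
    by rewrite memv_span ?mem_head.
  by rewrite memv_span // !inE eqxx orbT.
have lker_neq p x y : free [:: p; x; y] -> ~~ (lker (f p x) <= lker (f p y))%VS.
  move=> fr; apply/negP=> le.
  have frx : free [:: p; x] by free_from fr.
  have fry : free [:: p; y] by free_from fr.
  apply: (pi_injP partOm fr (fpi _ _ frx)).
  suff -> : lker (f p x) = lker (f p y) by apply: fpi.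
  by apply/eqP; rewrite eqEdim le (proj1 (fpi _ _ frx)) (proj1 (fpi _ _ fry)) /=.
have [||||||T [altT TP]] := @exists_alternating3 _ _ f.
- by rewrite dim_full ltnS ltn_neqAle eq_sym n3.
- exact: f0.
- by move=> p x fr; apply: pi_sub (fpi _ _ fr).
- move=> p x fr; apply: functional_proportional.
  have fr' : free [:: x; p] by rewrite free2C.
  suff -> : lker (f p x) = lker (f x p) by [].
  by apply: (pi_unique partOm (fpi _ _ fr)); rewrite span2C; apply: fpi.
- move=> p x y fr; have fr' : free [:: p; y; x] by free_from fr.
  apply: functional_lin2; try exact: lker_neq.
  have [S [<- S1 _]] := pencil_base _ _ _ fr.
  apply: S1; last first.
    by rewrite memvD // memv_span // !inE eqxx ?orbT.
  have h : free [:: x + y; y; p].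
    by rewrite free_addl ?memv_span ?mem_head //; free_from fr.
  by free_from h.
(* A linear relation would put the axis of the pencil inside the kernel of [f p z], forcing [z] into
   the plane of [p], [x], [y]. *)
- move=> p x y z a b fr; apply/eqP=> e.
  have fr3 : free [:: p; x; y] by free_from fr.
  have frz : free [:: p; z] by free_from fr.
  have [S [SE _ S2]] := pencil_base _ _ _ fr3.
  have : z \in <<[:: p; x; y]>>%VS.
    apply: S2 => //; rewrite SE; apply/subvP=> t; rewrite memv_cap !memv_kerE e.
    case/andP=> /eqP xt /eqP yt.
    by rewrite add_lfunE !scale_lfunE xt yt !scaler0 addr0.
  have : free [:: z; p; x; y] by free_from fr.
  by rewrite free_cons => /andP[/negPf ->].
exists T; split=> // p x H fr piH y.
by rewrite TP // (pi_unique partOm piH (fpi _ _ fr)).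
Qed.

End LinearPartitions.

Theorem theorem7p2 (F : fieldType) (n : nat) (hn : (2 <= n)%N)
    (Om : ({vspace 'rV[F]_(n.+1)} -> Prop) -> Prop) :
  line_partition Om ->
  (linear_complex (K_of Om) <-> linear_partition Om) /\
  (linear_partition Om -> forall l, ~ singular_line (K_of Om) l).
Proof.
move=> partOm; split; first split.
- move=> /(linear_complex_represents partOm)[T repT].
  exact: represents_linear_partition repT.
- move=> /(linear_partition_represents hn partOm)[T repT].
  exact: represents_linear_complex repT.
- move=> /(linear_partition_represents hn partOm)[T repT] l.
  exact: represents_no_singular_line repT l.
Qed.
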